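(* Let $(X,d_X)$ and $(Y,d_Y)$ be nonempty semimetric spaces and let $\Phi:X\to Y$ be a weak similarity with the scaling function $f:D(Y)\to D(X)$. If $f$ and $f^{-1}$ are subadditive in the generalized sense and $0\in\mathrm{ac}(D(X))\cap\mathrm{ac}(D(Y))$, then $\Phi$ is a similarity.
   Context: A semimetric on a set $X$ is a function $d:X\times X\to[0,\infty)$ with $d(x,y)=d(y,x)$ and $(d(x,y)=0\Leftrightarrow x=y)$ for all $x,y\in X$; $(X,d)$ is then a semimetric space. The distance set of a nonempty semimetric space is $D(X)=\{d(x,y):x,y\in X\}$. A surjective mapping $\Phi:X\to Y$ between nonempty semimetric spaces is a weak similarity if there is a strictly increasing function $f:D(Y)\to D(X)$ (a scaling function of $\Phi$) such that $d_X(x,y)=f(d_Y(\Phi(x),\Phi(y)))$ for all $x,y\in X$; such $f$ is automatically a bijection, with inverse $f^{-1}:D(X)\to D(Y)$. A mapping $\Phi:X\to Y$ is a similarity if it is bijective and there is $r>0$ (the ratio) with $d_Y(\Phi(x),\Phi(y))=r\,d_X(x,y)$ for all $x,y\in X$. For $A\subseteq[0,\infty)$, a function $g:A\to[0,\infty)$ is subadditive in the generalized sense if for every integer $m\geqslant1$ and all $x,x_1,\dots,x_m\in A$, $x\leqslant\sum_{i=1}^m x_i$ implies $g(x)\leqslant\sum_{i=1}^m g(x_i)$. For $A\subseteq[0,\infty)$, $\mathrm{ac}(A)$ is the set of all accumulation points of $A$ in $[0,\infty)$ with the standard topology. *)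

(* Defs.v *)
From mathcomp Require Export all_boot all_order all_algebra.
From mathcomp Require Export all_classical all_reals all_analysis.
Export Order.TTheory GRing.Theory Num.Theory.
Export numFieldNormedType.Exports.

Set Implicit Arguments.
Unset Strict Implicit.
Unset Printing Implicit Defensive.

Local Open Scope classical_set_scope.
Local Open Scope ring_scope.

Definition semimetric (R : realType) (X : Type) (d : X -> X -> R) : Prop :=
  [/\ forall x y, 0 <= d x y,
      forall x y, d x y = d y x &
      forall x y, d x y = 0 <-> x = y].

Definition distance_set (R : realType) (X : Type) (d : X -> X -> R) : set R :=
  [set d x y | x in [set: X] & y in [set: X]].

(* A function D(Y) -> D(X) is represented by a total f : R -> R that maps D(Y)
   into D(X); its values outside D(Y) are irrelevant. *)
Definition scaling_function (R : realType) (X Y : Type)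
    (dX : X -> X -> R) (dY : Y -> Y -> R) (Phi : X -> Y) (f : R -> R) : Prop :=
  [/\ {homo f : t / distance_set dY t >-> distance_set dX t},
      forall s t, distance_set dY s -> distance_set dY t -> s < t -> f s < f t &
      forall x y, dX x y = f (dY (Phi x) (Phi y))].

Definition weak_similarity_with (R : realType) (X Y : Type)
    (dX : X -> X -> R) (dY : Y -> Y -> R) (Phi : X -> Y) (f : R -> R) : Prop :=
  (forall y, exists x, Phi x = y) /\ scaling_function dX dY Phi f.

(* Since f is injective on D(Y) with image D(X), pinv (D(Y)) f coincides on
   D(X) with the inverse of f : D(Y) -> D(X). *)
Definition scaling_inverse (R : realType) (Y : Type) (dY : Y -> Y -> R)
    (f : R -> R) : R -> R :=
  pinv (distance_set dY) f.

Definition similarity (R : realType) (X Y : Type)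
    (dX : X -> X -> R) (dY : Y -> Y -> R) (Phi : X -> Y) : Prop :=
  bijective Phi /\
  exists r : R, 0 < r /\ forall x y, dY (Phi x) (Phi y) = r * dX x y.

Definition gen_subadditive (R : realType) (A : set R) (g : R -> R) : Prop :=
  forall (m : nat) (x : R) (xs : 'I_m -> R), (1 <= m)%N ->
    A x -> (forall i, A (xs i)) ->
    x <= \sum_(i < m) xs i -> g x <= \sum_(i < m) g (xs i).

(* For A included in [0, +oo[, the accumulation points of A in the subspace
   [0, +oo[ are its nonnegative limit points in R. *)
Definition ac (R : realType) (A : set R) : set R :=
  [set t : R | 0 <= t] `&` limit_point A.

Lemma scaling_inverse_bij (R : realType) (X Y : Type)
    (dX : X -> X -> R) (dY : Y -> Y -> R) (Phi : X -> Y) (f : R -> R) :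
  weak_similarity_with dX dY Phi f ->
  set_bij (distance_set dY) (distance_set dX) f /\
  [/\ set_bij (distance_set dX) (distance_set dY) (scaling_inverse dY f),
      {in distance_set dY, cancel f (scaling_inverse dY f)} &
      {in distance_set dX, cancel (scaling_inverse dY f) f}].
Proof.
move=> [Phis [fD fI fE]].
have finj : {in distance_set dY &, injective f}.
  move=> s t /set_mem sD /set_mem tD fst.
  by have [/(fI _ _ sD tD)|/(fI _ _ tD sD)|//] := ltgtP s t; rewrite fst ltxx.
have fsurj : set_surj (distance_set dY) (distance_set dX) f.
  move=> _ [x _ [y _ <-]]; exists (dY (Phi x) (Phi y)) => //.
  by exists (Phi x) => //; exists (Phi y).
have fbij : set_bij (distance_set dY) (distance_set dX) f by split.
split=> //; split; [exact: bijpinv_bij|exact: pinvKV|exact: surjpK].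
Qed.

(* Main.v *)
Require Import Defs.
From mathcomp Require Import ring lra.

Set Implicit Arguments.
Unset Strict Implicit.
Unset Printing Implicit Defensive.

Local Open Scope classical_set_scope.
Local Open Scope ring_scope.

(** Write [g] for the inverse of [f]. Covering [x] by about [x / a] copies of a
small [a] gives [f x / x <= (f a / a) * (1 + a / x)], and the same argument for
[g] gives [y / f y <= (a / f a) * (1 + f a / f y)]. Multiplying cancels
[f a / a]; since [a] and [f a] can be made small simultaneously, [f x / x] is
at most [f y / y] for all nonzero distances [x] and [y], hence constant. *)

Lemma limit_point0_small (R : realType) (A : set R) (e : R) :
  (forall t, A t -> 0 <= t) -> limit_point A 0 -> 0 < e ->
  exists2 a, A a & 0 < a < e.
Proof.
move=> A0 lA e0; have [a [an0 Aa]] := lA _ (nbhsx_ballx (0 : R) e e0).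
rewrite /ball /= sub0r normrN => ae; exists a => //.
by rewrite lt_neqAle eq_sym an0 A0 //= (le_lt_trans _ ae) ?ler_norm.
Qed.

(** With [n] the integer part of [x / a], the point [x] lies below the sum of [n + 1] copies of [a].
    The extra copy, needed since [n] copies may fall short, costs the error term [g a * a]. *)
Lemma gen_subadditive_le (R : realType) (A : set R) (g : R -> R) (x a : R) :
  gen_subadditive A g -> A x -> A a -> 0 <= x -> 0 < a -> 0 <= g a ->
  g x * a <= g a * (x + a).
Proof.
move=> gA Ax Aa x0 a0 ga0; set n := Num.truncn (x / a).
have /andP[nle nlt] : n%:R <= x / a < n.+1%:R.
  by rewrite truncn_itv // divr_ge0 // ltW.
have gx : g x <= g a *+ n.+1.
  have := gA n.+1 x (fun=> a) isT Ax (fun=> Aa).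
  rewrite !sumr_const card_ord; apply.
  by rewrite -mulr_natl -ler_pdivrMr // ltW.
apply: (le_trans (ler_wpM2r (ltW a0) gx)).
rewrite -mulr_natr -mulrA ler_wpM2l // -natr1 mulrDl mul1r lerD2r.
by rewrite -ler_pdivlMr.
Qed.

Lemma le_of_small_perturbations (R : realType) (c x v : R) :
  0 <= x -> 0 <= v ->
  (forall e, 0 < e -> c <= (x + e) * (v + e)) -> c <= x * v.
Proof.
move=> x0 v0 H; apply/ler_addgt0Pr => e e0.
have s0 : 0 < x + v + 1 by lra.
(* Since [d <= 1], the excess of [(x + d) * (v + d)] over [x * v] is
   [d * (x + v + d) <= d * (x + v + 1) <= e]. *)
pose d := Num.min 1 (e / (x + v + 1)).
have d0 : 0 < d by rewrite lt_min ltr01 divr_gt0.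
have d1 : d <= 1 by rewrite ge_min lexx.
have : d * (x + v + 1) <= e by rewrite -ler_pdivlMr // ge_min lexx orbT.
have := H d d0; nra.
Qed.

Section MutuallySubadditive.
Context (R : realType) (A B : set R) (f g : R -> R).
Hypotheses (A_ge0 : forall t, A t -> 0 <= t) (B_ge0 : forall t, B t -> 0 <= t).
Hypotheses (fAB : {homo f : t / A t >-> B t}) (gBA : {homo g : t / B t >-> A t}).
Hypotheses (fK : forall t, A t -> g (f t) = t).
Hypotheses (gK : forall t, B t -> f (g t) = t).
Hypothesis f_incr : forall s t, A s -> A t -> s < t -> f s < f t.
Hypotheses (A0 : A 0) (f0 : f 0 = 0).
Hypotheses (fsub : gen_subadditive A f) (gsub : gen_subadditive B g).
Hypotheses (lA : limit_point A 0) (lB : limit_point B 0).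

(** Without assuming [f] continuous at 0, small points are taken from both [A] and [B]. The smaller
    of [a] and [g b] serves, because [f] is increasing and [f (g b) = b]. *)
Lemma simultaneously_small (e : R) : 0 < e ->
  exists2 a, A a & [/\ 0 < a, a < e & f a < e].
Proof.
move=> e0.
have [a Aa /andP[a0 ae]] := limit_point0_small A_ge0 lA e0.
have [b Bb /andP[b0 be]] := limit_point0_small B_ge0 lB e0.
have gb0 : 0 < g b.
  rewrite lt_neqAle A_ge0 ?andbT; last exact: gBA.
  by apply/eqP => gb; move: b0; rewrite -(gK Bb) -gb f0 ltxx.
have [agb|gba] := ltP a (g b); last first.
  by exists (g b); [exact: gBA|rewrite gK//; split=> //; exact: le_lt_trans ae].
exists a => //; split=> //; apply: lt_trans be.
by rewrite -(gK Bb); apply: f_incr => //; exact: gBA.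
Qed.

(** Division-free form of [f x / x <= f y / y], which also makes sense at 0; the perturbations are
    [a] and [f a]. *)
Lemma cross_le (x y : R) : A x -> A y -> f x * y <= x * f y.
Proof.
move=> Ax Ay; apply: le_of_small_perturbations => [||e e0]; first exact: A_ge0.
  exact/B_ge0/fAB.
have [a Aa [a0 ae fae]] := simultaneously_small e0.
have fa0 : 0 < f a by rewrite -f0; exact: f_incr.
have x0 := A_ge0 Ax; have y0 := A_ge0 Ay.
have fy0 := B_ge0 (fAB Ay); have fx0 := B_ge0 (fAB Ax).
have Hf := gen_subadditive_le fsub Ax Aa x0 a0 (ltW fa0).
have := gen_subadditive_le gsub (fAB Ay) (fAB Aa) fy0 fa0.
rewrite !fK// => /(_ (ltW a0)) Hg.
apply: (@le_trans _ _ ((x + a) * (f y + f a))); last first.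
  by apply: ler_pM; rewrite ?addr_ge0 ?lerD2l // ltW.
(* After multiplication by [a * f a], the claim is the product of [Hf] and [Hg]. *)
rewrite -(ler_pM2r (mulr_gt0 a0 fa0)).
have -> : f x * y * (a * f a) = (f x * a) * (y * f a) by ring.
have -> : (x + a) * (f y + f a) * (a * f a) =
          (f a * (x + a)) * (a * (f y + f a)) by ring.
by apply: ler_pM; rewrite // mulr_ge0 // ltW.
Qed.

Lemma proportional_of_mutually_subadditive :
  exists2 r : R, 0 < r & forall t, A t -> t = r * f t.
Proof.
have [a Aa /andP[a0 _]] := limit_point0_small A_ge0 lA ltr01.
have fa0 : 0 < f a by rewrite -f0; exact: f_incr.
(* Any nonzero [a] fixes the ratio: [cross_le] at [(t, a)] and at [(a, t)] gives
   [t * f a = a * f t]. *)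
exists (a / f a) => [|t At]; first exact: divr_gt0.
apply: (mulIf (lt0r_neq0 fa0)); rewrite mulrAC divfK ?lt0r_neq0 //.
by apply/le_anti; rewrite {1}[t * _]mulrC {2}[a * _]mulrC !cross_le.
Qed.

End MutuallySubadditive.

Theorem theorem4p4 (R : realType) (X Y : Type)
    (dX : X -> X -> R) (dY : Y -> Y -> R) (Phi : X -> Y) (f : R -> R)
    (hX : semimetric dX) (hY : semimetric dY)
    (X0 : [set: X] !=set0) (Y0 : [set: Y] !=set0)
    (hPhi : weak_similarity_with dX dY Phi f)
    (hf : gen_subadditive (distance_set dY) f)
    (hfinv : gen_subadditive (distance_set dX) (scaling_inverse dY f))
    (h0 : (ac (distance_set dX) `&` ac (distance_set dY)) 0) :
  similarity dX dY Phi.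
Proof.
have [_ [[gBA _ _] fK gK]] := scaling_inverse_bij hPhi.
have [Phi_surj [fAB f_incr dXE]] := hPhi.
have [dX_ge0 _ dX_eq0] := hX; have [dY_ge0 _ dY_eq0] := hY.
have [[_ lB] [_ lA]] := h0.
have [x0 _] := X0.
have dYxx y : dY y y = 0 by apply/dY_eq0.
have f0 : f 0 = 0 by rewrite -[in LHS](dYxx (Phi x0)) -dXE; apply/dX_eq0.
have Phi_inj : injective Phi.
  by move=> x x' xx'; apply/dX_eq0; rewrite dXE xx' dYxx.
(* A right inverse obtained by choice; injectivity of [Phi] makes it two-sided. *)
have [Psi PhiK] := choice Phi_surj.
split; first by exists Psi => // x; exact: Phi_inj.
(* Here [A] is the distance set of [Y] and [B] that of [X], so [t = r * f t] at
   [t = dY (Phi x) (Phi x')] is the similarity equation. *)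
have [r r0 rE] : exists2 r : R, 0 < r &
    forall t, distance_set dY t -> t = r * f t.
  apply: (@proportional_of_mutually_subadditive _ _ (distance_set dX) _
    (scaling_inverse dY f)) => //.
  - by move=> _ [y _ [y' _ <-]].
  - by move=> _ [x _ [x' _ <-]].
  - by move=> t At; apply: fK; exact: mem_set.
  - by move=> t Bt; apply: gK; exact: mem_set.
  - by exists (Phi x0) => //; exists (Phi x0).
exists r; split=> // x x'; rewrite dXE; apply: rE.
by exists (Phi x) => //; exists (Phi x').
Qed.
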